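(* Let $n\ge1$. The map $$\Psi_{1,n}\colon\operatorname{Ch}\bigl(\mathcal H_n^{(1)}\bigr)\longrightarrow\{\mathtt a,\mathtt b\}^n/{\sim_1},\qquad C\longmapsto[\,\mathtt b^{\,n-r(C)}\mathtt a^{\,r(C)}\,]_{\sim_1},$$ is a bijection.
   Context: $\mathcal H_n^{(1)}$ is the arrangement in $\mathbb R$ of the points $H_i^{(1)}=\{x\in\mathbb R:1+ix=0\}$, $i\in\{1,\dots,n\}$. A chamber is a connected component of $\mathbb R\setminus\bigcup_iH_i^{(1)}$, and $\operatorname{Ch}(\mathcal H_n^{(1)})$ is the set of chambers. The sign word of a chamber $C$ is $\sigma(C)=\sigma_1\cdots\sigma_n\in\{+,-\}^n$ with $\sigma_i=\operatorname{sgn}(1+ix)$ for any $x\in C$. Each chamber sign word has the form ${+}^{\,n-r(C)}{-}^{\,r(C)}$ with $r(C)\in\{0,\dots,n\}$; this defines $r(C)$. For $u,w\in\{\mathtt a,\mathtt b\}^n$, $u\sim_1w$ (abelian equivalence) means that $u$ and $w$ have the same number of letters $\mathtt a$; $[w]_{\sim_1}$ is the class of $w$. *)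

(* Defs.v *)
From HB Require Import structures.
From mathcomp Require Import all_boot all_order all_algebra generic_quotient.
From mathcomp Require Import boolp classical_sets reals topology normedtype.

Set Implicit Arguments.
Unset Strict Implicit.
Unset Printing Implicit Defensive.

Import Order.TTheory GRing.Theory Num.Theory.
Import numFieldNormedType.Exports.

Local Open Scope classical_set_scope.
Local Open Scope ring_scope.
Local Open Scope quotient_scope.

Definition hyperplane (R : realType) (i : nat) : set R :=
  [set x | 1 + i%:R * x = 0].
Arguments hyperplane : clear implicits.

Definition arr_compl (R : realType) (n : nat) : set R :=
  ~` \bigcup_(i in [set i | (1 <= i <= n)%N]) hyperplane R i.
Arguments arr_compl : clear implicits.

Definition Ch (R : realType) (n : nat) : set (set R) :=
  [set connected_component (arr_compl R n) x | x in arr_compl R n].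
Arguments Ch : clear implicits.

(* The letters + and - are encoded as the integers 1 and -1. *)
Definition sign_word_at (R : realType) (n : nat) (x : R) : n.-tuple int :=
  [tuple sgz (1 + (i.+1)%:R * x) | i < n].

Lemma Ch_nonempty (R : realType) (n : nat) (C : Ch R n) :
  exists x, val C x.
Proof.
have [x Mx <-] := set_valP C.
by exists x; apply: connected_component_refl.
Qed.

Definition sign_word (R : realType) (n : nat) (C : Ch R n) : n.-tuple int :=
  sign_word_at n (sval (cid (Ch_nonempty C))).

Lemma arr_compl_neq0 (R : realType) (n i : nat) (x : R) :
  arr_compl R n x -> (i < n)%N -> 1 + (i.+1)%:R * x != 0.
Proof. by move=> Mx lt_in; apply/eqP => e; apply: Mx; exists i.+1. Qed.

Lemma Ch_sub (R : realType) (n : nat) (C : Ch R n) (x : R) :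
  val C x -> arr_compl R n x.
Proof.
by have [y _ <-] := set_valP C; apply: connected_component_sub.
Qed.

Lemma Ch_sgz_le (R : realType) (n : nat) (C : Ch R n) (i : nat) (x y : R) :
  (i < n)%N -> val C x -> val C y -> x <= y ->
  sgz (1 + (i.+1)%:R * x) = sgz (1 + (i.+1)%:R * y).
Proof.
move=> lt_in Cx Cy le_xy; set k : R := i.+1%:R.
have k0 : 0 < k by rewrite ltr0n.
have itvC : is_interval (val C).
  apply/connected_intervalP; have [z _ <-] := set_valP C.
  exact: component_connected.
have nx := arr_compl_neq0 (Ch_sub Cx) lt_in.
have ny := arr_compl_neq0 (Ch_sub Cy) lt_in.
rewrite -/k in nx ny.
have le_k : 1 + k * x <= 1 + k * y by rewrite lerD2l ler_pM2l.
case: (ltgtP 0 (1 + k * x)) nx => // hx _.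
  by rewrite !gtr0_sgz // (lt_le_trans hx).
case: (ltgtP 0 (1 + k * y)) ny => // hy _; last by rewrite !ltr0_sgz.
have ez : 1 + k * (- k^-1) = 0 by rewrite mulrN divff ?gt_eqF // subrr.
have Cz : val C (- k^-1).
  by apply: (itvC x y) => //; apply/andP; split;
    rewrite -(ler_pM2l k0) -(lerD2l 1) ez ltW.
by have := arr_compl_neq0 (Ch_sub Cz) lt_in; rewrite -/k ez eqxx.
Qed.

(* The sign word does not depend on the point of the chamber. *)
Lemma sign_wordE (R : realType) (n : nat) (C : Ch R n) (x : R) :
  val C x -> sign_word C = sign_word_at n x.
Proof.
move=> Cx; rewrite /sign_word; case: cid => y Cy /=.
apply/eq_from_tnth => i; rewrite !tnth_mktuple.
case/orP: (le_total x y) => le_xy; last first.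
  exact: (Ch_sgz_le (ltn_ord i) Cy Cx le_xy).
exact/esym/(Ch_sgz_le (ltn_ord i) Cx Cy le_xy).
Qed.

Lemma sign_word_form (R : realType) (n : nat) (C : Ch R n) :
  exists r : 'I_n.+1,
    sign_word C = nseq (n - r) (1 : int) ++ nseq r (- 1 : int) :> seq int.
Proof.
have [x Cx] := Ch_nonempty C; rewrite (sign_wordE Cx).
pose p i := 0 < 1 + (i.+1)%:R * x.
have pS i j : (i <= j)%N -> p j -> p i.
  rewrite /p => le_ij pj; have [x0|x0] := leP 0 x.
    by rewrite ltr_wpDr // mulr_ge0.
  by apply: lt_le_trans pj _; rewrite lerD2l ler_nM2r // ler_nat.
have [m le_mn pm] :
  exists2 m, (m <= n)%N & forall i, (i < n)%N -> p i = (i < m)%N.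
  elim: n {C Cx} => [|n [m le_mn IH]]; first by exists 0%N.
  case: (boolP (p n)) => pn.
    by exists n.+1 => // i lt_in; rewrite lt_in (pS _ n).
  exists m => [|i]; first exact: leqW.
  rewrite ltnS leq_eqVlt => /orP[/eqP->|]; last exact: IH.
  by rewrite (negPf pn) ltnNge le_mn.
have lt_r : (n - m < n.+1)%N by rewrite ltnS leq_subr.
exists (Ordinal lt_r); rewrite /= subKn //.
apply: (@eq_from_nth _ 0) => [|i].
  by rewrite size_map size_enum_ord size_cat !size_nseq subnKC.
rewrite size_map size_enum_ord => lt_in.
rewrite (nth_map (Ordinal lt_in)) ?size_enum_ord // nth_enum_ord //.
rewrite nth_cat size_nseq !nth_nseq.
have nx := arr_compl_neq0 (Ch_sub Cx) lt_in; have pmi := pm _ lt_in.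
case: (ltnP i m) pmi => [lt_im pi | le_mi pi]; first by rewrite gtr0_sgz.
by rewrite ltn_sub2rE // lt_in ltr0_sgz // lt_neqAle nx leNgt -/(p i) pi.
Qed.

Lemma sign_word_form_inj (n : nat) (r s : 'I_n.+1) :
  nseq (n - r) (1 : int) ++ nseq r (- 1 : int)
    = nseq (n - s) (1 : int) ++ nseq s (- 1 : int) -> r = s.
Proof.
move=> /(congr1 (count_mem (- 1 : int))).
by rewrite !count_cat !count_nseq /= !mul0n !mul1n !add0n => /val_inj.
Qed.

Definition neg_count (R : realType) (n : nat) (C : Ch R n) : 'I_n.+1 :=
  sval (cid (sign_word_form C)).

Variant letter := letter_a | letter_b.

Definition bool_of_letter (l : letter) : bool :=
  if l is letter_a then true else false.

Definition letter_of_bool (t : bool) : letter :=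
  if t then letter_a else letter_b.

Lemma bool_of_letterK : cancel bool_of_letter letter_of_bool.
Proof. by case. Qed.

HB.instance Definition _ := Finite.copy letter (can_type bool_of_letterK).

Definition abel_eq (n : nat) : rel (n.-tuple letter) :=
  fun u w => count_mem letter_a u == count_mem letter_a w.

Lemma abel_eq_refl (n : nat) : reflexive (@abel_eq n).
Proof. by move=> u; apply: eqxx. Qed.

Lemma abel_eq_sym (n : nat) : symmetric (@abel_eq n).
Proof. by move=> u w; apply: eq_sym. Qed.

Lemma abel_eq_trans (n : nat) : transitive (@abel_eq n).
Proof. by move=> v u w /eqP + /eqP; rewrite /abel_eq => -> ->. Qed.

Canonical abel_equiv (n : nat) : equiv_rel (n.-tuple letter) :=
  EquivRel (@abel_eq n) (@abel_eq_refl n) (@abel_eq_sym n) (@abel_eq_trans n).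

Definition abel_class (n : nat) : Type := {eq_quot abel_equiv n}.

Lemma size_ba_word (n : nat) (r : 'I_n.+1) :
  size (nseq (n - r) letter_b ++ nseq r letter_a) == n.
Proof. by rewrite size_cat !size_nseq subnK // -ltnS. Qed.

Definition ba_word (n : nat) (r : 'I_n.+1) : n.-tuple letter :=
  Tuple (size_ba_word r).

Definition Psi1 (R : realType) (n : nat) (C : Ch R n) : abel_class n :=
  \pi_({eq_quot abel_equiv n}) (ba_word (neg_count C)).
Arguments Psi1 : clear implicits.

(* Main.v *)
Require Import Defs.
From mathcomp Require Import all_boot all_order all_algebra.
From mathcomp Require Import reals.
From mathcomp Require Import generic_quotient zify.
From mathcomp Require Import boolp classical_sets topology normedtype.

(** A chamber of an arrangement of points on the line is determined by its sign
    word: if [x] and [y] have the same signs, no hyperplane separates them, so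
    the whole segment between them avoids the arrangement.  Conversely each
    [r <= n] occurs, since [- 2 / (2 (n - r) + 1)] lies between [- 1 / (n - r)]
    (or [-oo] if [r = n]) and [- 1 / (n - r + 1)].  Hence [C |-> r(C)] is a bijection onto
    [{0, .., n}], as is the number of letters [a] on abelian classes. *)

Set Implicit Arguments.
Unset Strict Implicit.
Unset Printing Implicit Defensive.

Import Order.TTheory GRing.Theory Num.Theory.
Import numFieldNormedType.Exports.

Local Open Scope classical_set_scope.
Local Open Scope ring_scope.
Local Open Scope quotient_scope.

(** Here [bijective] asks for a two-sided inverse; surjectivity only asserts that preimages exist,
    so one is picked by choice. *)
Lemma inj_surj_bijective (T U : Type) (f : T -> U) :
  injective f -> (forall u, exists t, f t = u) -> bijective f.
Proof.
move=> f_inj f_surj; pose g u := sval (cid (f_surj u)).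
have gK : cancel g f by move=> u; apply: svalP (cid (f_surj u)).
by exists g => // t; apply: f_inj; rewrite gK.
Qed.

Section Chambers.
Variables (R : realType) (n : nat).

Lemma arr_complP (x : R) :
  arr_compl R n x <-> forall i, (i < n)%N -> 1 + i.+1%:R * x != 0.
Proof.
split=> [Mx i|Hx [[|i] //= lt_in /eqP]]; first exact: arr_compl_neq0.
by rewrite (negPf (Hx i lt_in)).
Qed.

(** Each form [1 + i.+1%:R * x] increases with [x], so a zero at [z] would make it negative at [x]
    and nonnegative at [y], against equality of the signs. *)
Lemma sign_word_at_segment (x y z : R) :
  arr_compl R n x -> sign_word_at n x = sign_word_at n y ->
  x <= z <= y -> arr_compl R n z.
Proof.
move=> Mx eq_xy /andP[le_xz le_zy]; apply/arr_complP => i lt_in; apply/eqP => z0.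
have := congr1 (fun t => tnth t (Ordinal lt_in)) eq_xy.
rewrite !tnth_mktuple /=; have nx := arr_compl_neq0 Mx lt_in.
have mono (u v : R) : u <= v -> 1 + i.+1%:R * u <= 1 + i.+1%:R * v.
  by move=> le_uv; rewrite lerD2l ler_pM2l ?ltr0n.
have x_lt0 : 1 + i.+1%:R * x < 0 by rewrite lt_neqAle nx -z0 mono.
have y_ge0 : 0 <= 1 + i.+1%:R * y by rewrite -z0 mono.
by rewrite (ltr0_sgz x_lt0) => sgy; move: y_ge0; rewrite -sgz_ge0 -sgy.
Qed.

Lemma sign_word_at_component (x y : R) :
  arr_compl R n x -> sign_word_at n x = sign_word_at n y -> x <= y ->
  connected_component (arr_compl R n) x = connected_component (arr_compl R n) y.
Proof.
move=> Mx eq_xy le_xy; apply: same_connected_component.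
have seg_conn : connected `[x, y].
  by apply/connected_intervalP; apply: interval_is_interval.
apply: (connected_component_max _ _ seg_conn).
- by rewrite /= in_itv /= lexx.
- by move=> z /=; rewrite in_itv /=; apply: sign_word_at_segment.
- by rewrite /= in_itv /= lexx le_xy.
Qed.

(** Membership in [Ch] provides some base point; this lets any point of the chamber serve
    instead. *)
Lemma chamber_component (C : Ch R n) (x : R) :
  val C x -> val C = connected_component (arr_compl R n) x.
Proof.
by have [y My <-] := set_valP C => Cx; apply: same_connected_component.
Qed.

Lemma sign_word_inj : injective (@sign_word R n).
Proof.
move=> C D; have [x Cx] := Ch_nonempty C; have [y Dy] := Ch_nonempty D.
rewrite (sign_wordE Cx) (sign_wordE Dy) => eq_xy; apply: val_inj.
rewrite (chamber_component Cx) (chamber_component Dy).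
case/orP: (le_total x y) => le_xy.
  exact: sign_word_at_component (Ch_sub Cx) eq_xy le_xy.
exact/esym/(sign_word_at_component (Ch_sub Dy) (esym eq_xy) le_xy).
Qed.

Lemma sign_word_neg_count (C : Ch R n) :
  sign_word C = nseq (n - neg_count C) 1 ++ nseq (neg_count C) (- 1) :> seq int.
Proof. exact: svalP (cid (sign_word_form C)). Qed.

Lemma neg_count_inj : injective (@neg_count R n).
Proof.
move=> C D eq_r; apply: sign_word_inj; apply: val_inj.
by rewrite /= !sign_word_neg_count eq_r.
Qed.

Lemma neg_count_surj (r : 'I_n.+1) : exists C : Ch R n, neg_count C = r.
Proof.
pose m := (n - r)%N; pose d : R := (2 * m + 1)%:R.
pose x : R := - (2 / d).
have d_gt0 : 0 < d by rewrite ltr0n addn1.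
(* The numerator is [2 * (m - i) - 1]: being odd it never vanishes, and it is positive exactly when
   [i < m]. *)
have xE i : 1 + i.+1%:R * x = (d - (2 * i.+1)%:R) / d.
  by rewrite mulrBl divff ?gt_eqF // /x mulrN mulrA -natrM mulnC.
have sgx i : sgz (1 + i.+1%:R * x) = if (i < m)%N then 1 else - 1.
  rewrite xE; case: ltnP => [lt_im|le_mi].
    by rewrite gtr0_sgz // divr_gt0 // subr_gt0 ltr_nat; lia.
  by rewrite ltr0_sgz // pmulr_llt0 ?invr_gt0 // subr_lt0 ltr_nat; lia.
have Mx : arr_compl R n x.
  by apply/arr_complP => i _; rewrite -sgz_eq0 sgx; case: ifP.
have CP : connected_component (arr_compl R n) x \in Ch R n.
  by rewrite inE; exists x.
pose C : Ch R n := SigSub CP.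
have Cx : val C x by apply: connected_component_refl.
exists C; apply: sign_word_form_inj; rewrite -sign_word_neg_count (sign_wordE Cx).
apply: (@eq_from_nth _ 0) => [|i]; rewrite size_tuple.
  by rewrite size_cat !size_nseq subnK // -ltnS.
move=> lt_in; rewrite -(tnth_nth _ _ (Ordinal lt_in)) tnth_mktuple sgx /=.
rewrite nth_cat size_nseq !nth_nseq -/m; case: ltnP => // le_mi.
(* The default [0] of [nth] is never reached, since [i < n = m + r] gives [i - m < r]. *)
by have := ltn_ord r; rewrite /m in le_mi *; case: ifP => //; lia.
Qed.

End Chambers.

Lemma count_ba_word (n : nat) (r : 'I_n.+1) :
  count_mem letter_a (ba_word r) = r.
Proof. by rewrite count_cat !count_nseq /= mul0n mul1n. Qed.

Lemma abel_class_ba_word_inj (n : nat) :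
  injective (fun r : 'I_n.+1 => \pi_({eq_quot abel_equiv n}) (ba_word r)).
Proof.
move=> r s /eqquotP; rewrite /= /abel_eq !count_ba_word => /eqP.
exact: val_inj.
Qed.

(** The number of letters [a] in any representative serves as [r]; it is at most the length [n]. *)
Lemma abel_class_ba_word_surj (n : nat) (c : abel_class n) :
  exists r : 'I_n.+1, \pi_({eq_quot abel_equiv n}) (ba_word r) = c.
Proof.
elim/quotW: c => u.
have lt_r : (count_mem letter_a u < n.+1)%N.
  by rewrite ltnS -[leqRHS](size_tuple u) count_size.
by exists (Ordinal lt_r); apply/eqquotP; rewrite /= /abel_eq count_ba_word.
Qed.

Theorem proposition5 (R : realType) (n : nat) (n_ge1 : (1 <= n)%N) :
  bijective (Psi1 R n).
Proof.
apply: inj_surj_bijective => [C D|c].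
  (* [Psi1] is the composite of [neg_count] with the map sending [r] to the class of [ba_word r]. *)
  by move=> /abel_class_ba_word_inj; apply: neg_count_inj.
have [r <-] := abel_class_ba_word_surj c.
by have [C <-] := neg_count_surj R r; exists C.
Qed.
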